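(* The following two statements are equivalent: (1) for every stream $s$, if the set $\mathcal{R}_s$ of red positions of $s$ is streamless, then $\mu\mathcal{W}\,s$; (2) for every stream $s$, if $\succ_s$ is strongly normalizing at $0$, then $0$ is accessible with respect to $\succ_s$, i.e. $\mathit{acc}_{\succ_s}\,0$.
   Context: The equivalence is to be proved constructively (intuitionistic type theory with inductive and coinductive definitions; no excluded middle, no Markov's principle). A color is one of $R$ (red), $B$ (blue). A stream is an element of the coinductive type whose only constructor forms $c\,s$ from a color $c$ and a stream $s$; streams are considered up to bisimilarity (equivalently, functions $\mathbb{N}\to\{R,B\}$ up to pointwise equality). $s@n$ denotes the color of $s$ at position $n$ (positions start at $0$). For a stream predicate $X$, the weak until predicate $\mathcal{W}_X$ is defined coinductively by the rules: $\mathcal{W}_X\,s$ implies $\mathcal{W}_X\,(B\,s)$; $X\,s$ implies $\mathcal{W}_X\,(R\,s)$. The operator $X\mapsto\mathcal{W}_X$ is monotone, and $\mu\mathcal{W}$ is its least fixed point, i.e. the predicate defined inductively by the rule: $\mathcal{W}_{\mu\mathcal{W}}\,s$ implies $\mu\mathcal{W}\,s$ (equivalently, Mendler-style: if $X$ is a stream predicate with $\forall s'.\,X\,s'\Rightarrow\mu\mathcal{W}\,s'$ and $\mathcal{W}_X\,s$, then $\mu\mathcal{W}\,s$). $\mathcal{R}_s=\{n\in\mathbb{N}\mid s@n=R\}$. For a set $A$, the duplicate-free colists $\mathit{colist}\,A$ over $A$ are defined coinductively: $\langle\rangle:\mathit{colist}\,A$; and if $x\in A$ and $\ell:\mathit{colist}\,(A\setminus\{x\})$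 then $x\,\ell:\mathit{colist}\,A$. Finiteness $\ell\downarrow$ is defined inductively: $\langle\rangle\downarrow$; and $\ell\downarrow$ implies $(x\,\ell)\downarrow$. $A$ is streamless if $\ell\downarrow$ for every $\ell:\mathit{colist}\,A$. For a stream $s$, the relation $\succ_s$ on $\mathbb{N}$ is: $n\succ_s m$ iff there is $\ell$ with $n\le\ell$, $s@k=B$ for all $k$ with $n\le k<\ell$, $s@\ell=R$, and $m=\ell+1$. For a binary relation $\succ$ on a set $U$: accessibility is defined inductively by the rule: if $\mathit{acc}_\succ\,m$ for all $m$ with $n\succ m$, then $\mathit{acc}_\succ\,n$. Descending chains are defined coinductively: $\langle\rangle:\mathit{chain}_\succ\,x_0$ for $x_0\in U$; and if $x_0\succ x_1$ and $\ell:\mathit{chain}_\succ\,x_1$ then $x_1\,\ell:\mathit{chain}_\succ\,x_0$. Finiteness of chains is defined by the same inductive rules as for colists. $\succ$ is strongly normalizing at $x$ if every $\ell:\mathit{chain}_\succ\,x$ is finite. *)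

(* Defs.v *)
From Stdlib Require Export Arith Streams.

Set Implicit Arguments.
Unset Strict Implicit.

Inductive color : Set := R | B.

CoInductive W (X : Stream color -> Prop) : Stream color -> Prop :=
| W_B (s : Stream color) : W X s -> W X (Cons B s)
| W_R (s : Stream color) : X s -> W X (Cons R s).

(* The plain rule [W muW s -> muW s] nests a coinductive predicate inside an
   inductive one and yields no usable recursor in Rocq, so the least fixed point
   is given by the Mendler-style rule; [muW_fold] and [muW_least] confirm that
   it is the least predicate closed under the plain rule. *)
Inductive muW (s : Stream color) : Prop :=
| muW_intro (X : Stream color -> Prop) :
    (forall s', X s' -> muW s') -> W X s -> muW s.

Lemma W_mono (X Y : Stream color -> Prop) :
  (forall s, X s -> Y s) -> forall s, W X s -> W Y s.
Proof.
intros XY; cofix F; intros s [s' w | s' x].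
- exact (W_B (F s' w)).
- exact (W_R (XY s' x)).
Qed.

Lemma muW_fold (s : Stream color) : W muW s -> muW s.
Proof. exact (muW_intro (fun s' h => h)). Qed.

Lemma muW_least (P : Stream color -> Prop) :
  (forall s, W P s -> P s) -> forall s, muW s -> P s.
Proof.
intros HP; fix F 2; intros s [X HX w].
apply HP; exact (W_mono (fun s' x => F s' (HX s' x)) w).
Qed.

Definition red_positions (s : Stream color) : nat -> Prop :=
  fun n => Str_nth n s = R.

Definition remove (U : Type) (A : U -> Prop) (x : U) : U -> Prop :=
  fun y => A y /\ y <> x.

(* Colists and chains are data, hence in [Type]; only their finiteness is a
   proposition. *)
CoInductive colist (U : Type) (A : U -> Prop) : Type :=
| conil : colist A
| cocons (x : U) : A x -> colist (remove A x) -> colist A.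

Inductive colist_finite (U : Type) (A : U -> Prop) : colist A -> Prop :=
| conil_finite : colist_finite (conil A)
| cocons_finite (x : U) (Ax : A x) (l : colist (remove A x)) :
    colist_finite l -> colist_finite (cocons Ax l).

Definition streamless (U : Type) (A : U -> Prop) : Prop :=
  forall l : colist A, colist_finite l.

(* [next_red s n m] is n \succ_s m. *)
Definition next_red (s : Stream color) (n m : nat) : Prop :=
  exists l, n <= l /\ (forall k, n <= k < l -> Str_nth k s = B) /\
            Str_nth l s = R /\ m = l + 1.

CoInductive chain (U : Type) (succ : U -> U -> Prop) (x0 : U) : Type :=
| chnil : chain succ x0
| chcons (x1 : U) : succ x0 x1 -> chain succ x1 -> chain succ x0.

Inductive chain_finite (U : Type) (succ : U -> U -> Prop) (x0 : U) :
    chain succ x0 -> Prop :=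
| chnil_finite : chain_finite (chnil succ x0)
| chcons_finite (x1 : U) (h : succ x0 x1) (l : chain succ x1) :
    chain_finite l -> chain_finite (chcons h l).

Definition strongly_normalizing (U : Type) (succ : U -> U -> Prop) (x : U) :
    Prop :=
  forall l : chain succ x, chain_finite l.

(* [Acc] goes from [x] to the [y] with [lt y x], so the relation is flipped. *)
Definition acc (U : Type) (succ : U -> U -> Prop) (x : U) : Prop :=
  Acc (fun m n => succ n m) x.

(* Main.v *)
(** [mu W s] and accessibility of [0] are equivalent for each [s], and so are
    streamlessness of the red positions and strong normalization at [0]; no
    classical principle is used.  A descending chain from [0] lists red
    positions in increasing order, so it is a duplicate-free colist.
    Conversely, to extend a chain at [n] by means of a duplicate-free colist of
    red positions, read [n + 1] of its entries: either the colist ends, or one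
    of the entries is at least [n], and a bounded search then finds the first
    red position from [n] on. *)
From Stdlib Require Import List Lia.
Require Import Defs.

Set Implicit Arguments.
Unset Strict Implicit.

Lemma Str_nth_step (A : Type) (s : Stream A) (n : nat) :
  Str_nth_tl n s = Cons (Str_nth n s) (Str_nth_tl (S n) s).
Proof.
unfold Str_nth; simpl; rewrite <- tl_nth_tl.
now destruct (Str_nth_tl n s).
Qed.

Lemma next_red_shift (s : Stream color) (p n m : nat) :
  next_red s (n + p) m ->
  exists m', m = m' + p /\ next_red (Str_nth_tl p s) n m'.
Proof.
intros [l [nl [blue [red ->]]]].
exists (l - p + 1); split; [lia|].
exists (l - p); repeat split; [lia | | ].
- intros k Hk; rewrite Str_nth_plus; apply blue; lia.
- rewrite Str_nth_plus; replace (l - p + p) with l by lia; exact red.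
Qed.

(** The induction in [muW_acc] yields accessibility of [0] in a suffix; this carries it back to the
    position of [s] where the suffix starts. *)
Lemma acc_shift (s : Stream color) (p n : nat) :
  acc (next_red (Str_nth_tl p s)) n -> acc (next_red s) (n + p).
Proof.
induction 1 as [n _ IH]; constructor; intros m nm.
destruct (next_red_shift nm) as [m' [-> nm']].
exact (IH m' nm').
Qed.

(** Each inversion of [W] consumes one blue cell; the red cell after them exposes [X]. *)
Lemma W_first_red (X : Stream color -> Prop) (l : nat) (s : Stream color) :
  W X s -> (forall k, k < l -> Str_nth k s = B) -> Str_nth l s = R ->
  X (Str_nth_tl (S l) s).
Proof.
revert s; induction l as [|l IH]; intros s [s' w | s' x] blue red.
- discriminate red.
- exact x.
- apply (IH s' w); [|exact red].
  intros k kl; apply (blue (S k)); lia.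
- discriminate (blue 0 (Nat.lt_0_succ l)).
Qed.

Lemma muW_acc (s : Stream color) : muW s -> acc (next_red s) 0.
Proof.
revert s; apply muW_least; intros s w.
constructor; intros m [l [_ [blue [red ->]]]].
rewrite Nat.add_1_r; apply (@acc_shift s (S l) 0).
apply (W_first_red w); [|exact red].
intros k kl; apply blue; lia.
Qed.

Lemma W_next_red (X : Stream color -> Prop) (s : Stream color) (n : nat) :
  (forall m, next_red s n m -> X (Str_nth_tl m s)) ->
  W X (Str_nth_tl n s).
Proof.
intros HX.
(* The coinduction carries the blue stretch from [n] to [k], so that a red cell met at [k] is the
   first one from [n] on. *)
enough (H : forall k, n <= k -> (forall j, n <= j < k -> Str_nth j s = B) ->
            W X (Str_nth_tl k s)) by (apply H; intros; lia).
cofix F; intros k nk blue.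
rewrite Str_nth_step.
destruct (Str_nth k s) eqn:E; constructor.
- apply HX; exists k; repeat split; trivial; lia.
- apply F; [lia|].
  intros j Hj; destruct (Nat.eq_dec j k) as [->|jk]; [exact E|].
  apply blue; lia.
Qed.

Lemma acc_muW (s : Stream color) (n : nat) :
  acc (next_red s) n -> muW (Str_nth_tl n s).
Proof.
induction 1 as [n _ IH].
apply muW_fold, W_next_red, IH.
Qed.

Section ColistOfChain.

Variable s : Stream color.

(** Invariant of [colist_of_chain]: the entries already listed lie below [n], so [A] still offers
    every red position that a chain from [n] can visit. *)
Definition contains_reds (A : nat -> Prop) (n : nat) : Prop :=
  forall m, n <= m -> Str_nth m s = R -> A m.

Lemma contains_reds_pred A n m :
  contains_reds A n -> next_red s n m -> A (pred m).
Proof.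
intros HA [l [nl [_ [red ->]]]].
rewrite Nat.add_1_r; exact (HA l nl red).
Qed.

Lemma contains_reds_remove A n m :
  contains_reds A n -> next_red s n m -> contains_reds (remove A (pred m)) m.
Proof.
intros HA [l [nl [_ [_ ->]]]] k lk red; split.
- apply HA; [lia | exact red].
- lia.
Qed.

CoFixpoint colist_of_chain A n (HA : contains_reds A n)
    (c : chain (next_red s) n) : colist A :=
  match c with
  | chnil _ _ => conil A
  | chcons h c' =>
      cocons (contains_reds_pred HA h)
        (colist_of_chain (contains_reds_remove HA h) c')
  end.

Definition colist_unfold (U : Type) (A : U -> Prop) (l : colist A) : colist A :=
  match l with
  | conil _ => conil A
  | cocons Ax l' => cocons Ax l'
  end.

Lemma colist_unfold_eq (U : Type) (A : U -> Prop) (l : colist A) :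
  l = colist_unfold l.
Proof. now destruct l. Qed.

(** The equation keeps the colist a variable for the induction on its finiteness; [HA] is arbitrary
    because the tail comes with its own proof of the invariant. *)
Lemma chain_finite_of_colist A (l : colist A) :
  colist_finite l ->
  forall n (HA : contains_reds A n) (c : chain (next_red s) n),
  l = colist_of_chain HA c -> chain_finite c.
Proof.
induction 1 as [A | A x Ax l _ IH]; intros n HA [|m h c] E;
  try constructor; rewrite (colist_unfold_eq (colist_of_chain _ _)) in E;
  simpl in E.
- discriminate E.
- (* A match on the colist reads off the tail, where [injection] would leave
     an equality between dependent pairs. *)
  pose (tail_ok (l0 : colist A) :=
          match l0 with
          | conil _ => False
          | @cocons _ _ y _ l' =>
              exists HA' : contains_reds (remove A y) m,
                l' = colist_of_chain HA' c
          end).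
  assert (Htl : tail_ok (cocons Ax l)) by (rewrite E; eexists; reflexivity).
  destruct Htl as [HA' E']; exact (IH m HA' c E').
Qed.

Lemma streamless_SN :
  streamless (red_positions s) -> strongly_normalizing (next_red s) 0.
Proof.
intros H c.
assert (HA : contains_reds (red_positions s) 0) by (intros m _ red; exact red).
exact (chain_finite_of_colist (H (colist_of_chain HA c)) eq_refl).
Qed.

End ColistOfChain.

(* Constructive pigeonhole: [L] bounds what [A] can offer below [n], and every
   entry read below [n] shrinks it. *)
Lemma colist_large_or_finite (n k : nat) (L : list nat) (A : nat -> Prop)
    (l : colist A) :
  length L < k -> (forall x, A x -> x < n -> In x L) ->
  {x | n <= x /\ A x} + {colist_finite l}.
Proof.
revert L A l; induction k as [|k IH]; intros L A l Lk HL; [lia|].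
destruct l as [|x Ax l]; [right; constructor|].
destruct (le_lt_dec n x) as [nx|xn]; [left; now exists x|].
destruct (IH (List.remove Nat.eq_dec x L) _ l) as [[y [ny [Ay _]]]|fin].
- pose proof (remove_length_lt Nat.eq_dec L x (HL x Ax xn)); lia.
- intros y [Ay yx] yn; apply in_in_remove; [exact yx | exact (HL y Ay yn)].
- left; now exists y.
- right; now constructor.
Defined.

Lemma next_red_search (s : Stream color) (n x : nat) :
  n <= x -> Str_nth x s = R -> {m | next_red s n m}.
Proof.
intros nx red.
(* [d] is the distance left to the known red cell [x], which bounds the search. *)
enough (H : forall d k, n <= k -> x = d + k ->
            (forall j, n <= j < k -> Str_nth j s = B) -> {m | next_red s n m})
  by (apply (H (x - n) n); intros; lia).
induction d as [|d IH]; intros k nk xk blue.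
- exists (x + 1), x; subst x; simpl in *; now repeat split.
- destruct (Str_nth k s) eqn:E.
  + exists (k + 1), k; now repeat split.
  + apply (IH (S k)); [lia | lia |].
    intros j Hj; destruct (Nat.eq_dec j k) as [->|jk]; [exact E|].
    apply blue; lia.
Defined.

Section ChainOfColist.

Variables (s : Stream color) (l : colist (red_positions s)).

Lemma next_red_or_finite (n : nat) : {m | next_red s n m} + {colist_finite l}.
Proof.
(* [seq 0 n] lists all the [n] numbers below [n], so [S n] entries suffice. *)
destruct (@colist_large_or_finite n (S n) (seq 0 n) _ l)
  as [[x [nx red]]|fin].
- rewrite length_seq; lia.
- intros x _ xn; apply in_seq; lia.
- left; exact (next_red_search nx red).
- now right.
Defined.

(** Every step reads [l] afresh from its head, so no remaining colist has to be carried along. *)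
CoFixpoint chain_of_colist (n : nat) : chain (next_red s) n :=
  match next_red_or_finite n with
  | inleft (exist _ m h) => chcons h (chain_of_colist m)
  | inright _ => chnil (next_red s) n
  end.

Definition chain_unfold (U : Type) (succ : U -> U -> Prop) (x : U)
    (c : chain succ x) : chain succ x :=
  match c with
  | chnil _ _ => chnil succ x
  | chcons h c' => chcons h c'
  end.

Lemma chain_unfold_eq (U : Type) (succ : U -> U -> Prop) (x : U)
    (c : chain succ x) :
  c = chain_unfold c.
Proof. now destruct c. Qed.

(** The chain stops only where [next_red_or_finite] has returned a proof that [l] is finite, and a
    finite chain reaches such a stop. *)
Lemma colist_finite_of_chain n (c : chain (next_red s) n) :
  chain_finite c -> c = chain_of_colist n -> colist_finite l.
Proof.
induction 1 as [n | n m h c _ IH]; intros E;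
  rewrite (chain_unfold_eq (chain_of_colist n)) in E; simpl in E;
  destruct (next_red_or_finite n) as [[m' h']|fin]; try exact fin.
- discriminate E.
- apply IH.
  (* As for colists, a match reads off the tail without an equality between dependent pairs. *)
  pose (tail_ok (c0 : chain (next_red s) n) :=
          match c0 with
          | chnil _ _ => False
          | @chcons _ _ _ y _ c' => c' = chain_of_colist y
          end).
  change (tail_ok (chcons h c)).
  now rewrite E.
Qed.

End ChainOfColist.

Lemma SN_streamless (s : Stream color) :
  strongly_normalizing (next_red s) 0 -> streamless (red_positions s).
Proof.
intros H l.
exact (colist_finite_of_chain (H (chain_of_colist l 0)) eq_refl).
Qed.

Theorem corollary4p1 :
  (forall s : Stream color, streamless (red_positions s) -> muW s) <->
  (forall s : Stream color,
      strongly_normalizing (next_red s) 0 -> acc (next_red s) 0).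
Proof.
split; intros H s Hs.
- exact (muW_acc (H s (SN_streamless Hs))).
- exact (acc_muW (H s (streamless_SN Hs))).
Qed.
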